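(* Let $D$ be an odd diagram in $S_n$ whose odd diagram class has more than one element, and write $\mathrm{Perm}(D)=[u,v]$ as a Bruhat interval. Let $k=\min\{i: u^{-1}(i)\ne v^{-1}(i)\}$, $a=u^{-1}(k)$, $b=v^{-1}(k)$, let $$\{a=a_1<a_2<\cdots<a_m=b\}=\{a\le i\le b : u(a)\le u(i)\le u(b)\},$$ and for $1\le i\le m$ let $[u,v]^{(i)}=\{w\in[u,v] : w^{-1}(k)=a_i\}$. Then the blocks $[u,v]^{(1)},\dots,[u,v]^{(m)}$ all have the same cardinality.
   Context: $S_n$ is the symmetric group of permutations of $[n]=\{1,\dots,n\}$. For $i<j$, $w\,(i\ j)$ is the permutation obtained from $w$ by swapping the values $w(i)$ and $w(j)$ (at positions $i$ and $j$). The Bruhat order $\le$ on $S_n$ is the reflexive transitive closure of the relations $w<w\,(i\ j)$ for $i<j$ and $w(i)<w(j)$; $[u,v]=\{w\in S_n: u\le w\le v\}$. The odd diagram of $w\in S_n$ is $$D_o(w)=\{(i,j)\in[n]\times[n] : w(i)>j,\ i<w^{-1}(j),\ i\not\equiv w^{-1}(j) \pmod 2\}.$$ A subset $D\subseteq[n]\times[n]$ is an odd diagram if $D=D_o(w)$ for some $w\in S_n$. Its odd diagram class is $\mathrm{Perm}(D)=\{w\in S_n: D_o(w)=D\}$. It is a known theorem (Brenti, Carnevale and Tenner) that each odd diagram class is an interval $[u,v]$ in the Bruhat order. With the notation of the claim it is the case that $a<b$, $u(a)<u(b)$, and every $w\in[u,v]$ has $w^{-1}(k)\in\{a_1,\dots,a_m\}$,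 so the sets $[u,v]^{(i)}$ partition $[u,v]$. *)

(* Defs.v *)
From mathcomp Require Import all_boot all_fingroup.
Set Implicit Arguments.
Unset Strict Implicit.
Unset Printing Implicit Defensive.

(* [n] is represented by 'I_n = {0, .., n-1}: positions and values are both
   shifted by one, which preserves every comparison and the relation
   "different parity" below. *)

(* Permutations compose from left to right: (s * t) x = t (s x).  Hence
   tperm i j * w is w precomposed with (i j), i.e. w with the values at the
   positions i and j exchanged. *)
Definition bruhat_step (n : nat) : rel 'S_n := fun w w' =>
  [exists i : 'I_n, exists j : 'I_n,
     [&& i < j, w i < w j & w' == (tperm i j * w)%g]].

Definition bruhat (n : nat) : rel 'S_n := connect (@bruhat_step n).

Definition bruhat_interval (n : nat) (u v : 'S_n) : {set 'S_n} :=
  [set w | bruhat u w & bruhat w v].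

Definition odd_diagram (n : nat) (w : 'S_n) : {set 'I_n * 'I_n} :=
  [set p : 'I_n * 'I_n |
     [&& p.2 < w p.1, p.1 < (w^-1)%g p.2 & odd p.1 != odd ((w^-1)%g p.2)]].

Definition is_odd_diagram (n : nat) (D : {set 'I_n * 'I_n}) : Prop :=
  exists w : 'S_n, D = odd_diagram w.

Definition odd_diagram_class (n : nat) (D : {set 'I_n * 'I_n}) : {set 'S_n} :=
  [set w | odd_diagram w == D].

Definition block (n : nat) (u v : 'S_n) (k p : 'I_n) : {set 'S_n} :=
  [set w in bruhat_interval u v | (w^-1)%g k == p].

(* Main.v *)
Require Import Defs.
From mathcomp Require Import all_boot all_fingroup.
From mathcomp Require Import zify.
Set Implicit Arguments.
Unset Strict Implicit.
Unset Printing Implicit Defensive.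

(** Any two of the blocks are exchanged by one transposition of positions:
    if [p] and [q] are two of the positions [a_1, ..., a_m], then
    [w |-> w (p q)] maps the [w] of the class with [w p = k] injectively to
    those with [w q = k], so that neither block is larger than the other.

    That [w (p q)] has the same odd diagram as [w] rests on three facts.
    - All [w] between [u] and [v] agree with [u] on the positions of the values below
      [k] ([interval_small_values]): the sum of the positions of the values
      below [t] can only increase along the Bruhat order, and it takes the
      same value at [u] and at [v] as long as [t <= k].
    - Among the positions between [a] and [b], those that carry a value
      [>= k] all have the parity of [a] ([run_parity]), because one of the
      other parity would put a point in column [k] of the diagram of [v]
      but not of that of [u].
    - Row [a_i] of the diagram has no point in a column beyond [k]
      ([row_no_large]): a point [(a_i, l)] of the diagram of [u] would push
      the value [l] beyond position [b], by the parity fact, so [(b, l)] would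
      be a point as well, whereas [v b = k < l].

    Exchanging the values at [p] and [q] could alter the diagram in two ways
    only: through an entry of the other parity located between [p] and [q],
    which the second fact excludes, or through a value between [k] and [w q]
    located beyond [q], which is a point of row [q], excluded by the third. *)

(** * Positions of small values along the Bruhat order *)

(** Summing the positions of the values below [t], rather than counting
    entries in rectangles, gives a statistic that is monotone in the Bruhat order and
    whose increments in [t] are the positions themselves. *)
Definition small_weight n (t : nat) (w : 'S_n) : nat :=
  \sum_(x < n) (w x < t) * x.

Lemma small_weight_step n t (w w' : 'S_n) :
  bruhat_step w w' -> small_weight t w <= small_weight t w'.
Proof.
case/existsP=> i /existsP[j /and3P[lt_ij lt_w /eqP->]].
have ne_ji : j != i by rewrite neq_ltn lt_ij orbT.
rewrite /small_weight [leqLHS](bigD1 i) // [leqRHS](bigD1 i) //=.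
rewrite [in leqLHS](bigD1 j) // [in leqRHS](bigD1 j) //=.
rewrite !permM tpermL tpermR !addnA; apply: leq_add; last first.
  apply: leq_sum => x /andP[ne_xi ne_xj].
  by rewrite permM tpermD // eq_sym.
(* The smaller of the two exchanged values moves to the right. *)
by case: (ltnP (w i) t); case: (ltnP (w j) t); lia.
Qed.

Lemma small_weight_le n t (w w' : 'S_n) :
  bruhat w w' -> small_weight t w <= small_weight t w'.
Proof.
case/connectP=> p; elim: p w => [|x p IHp] w /=; first by move=> _ ->.
case/andP=> step_wx path_xp last_w'.
exact: leq_trans (small_weight_step t step_wx) (IHp x path_xp last_w').
Qed.

Lemma small_weightS n (w : 'S_n) (l : 'I_n) :
  small_weight l.+1 w = small_weight l w + (w^-1)%g l.
Proof.
rewrite /small_weight (bigD1 ((w^-1)%g l)) //=.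
rewrite [in RHS](bigD1 ((w^-1)%g l)) //= permKV ltnn ltnSn mul1n mul0n add0n.
rewrite addnC; congr (_ + _); apply: eq_bigr => x ne_x.
have ne_wx : w x != l by apply: contraNneq ne_x => <-; rewrite permK.
rewrite -(inj_eq val_inj) /= in ne_wx.
by rewrite ltnS leq_eqVlt (negbTE ne_wx).
Qed.

Lemma eq_small_weight n (w w' : 'S_n) (t : nat) :
    (forall l : 'I_n, l < t -> (w^-1)%g l = (w'^-1)%g l) ->
  small_weight t w = small_weight t w'.
Proof.
have reindexE (x : 'S_n) :
    small_weight t x = \sum_(l < n) (l < t) * (x^-1)%g l.
  rewrite /small_weight (reindex_inj (@perm_inj _ (x^-1)%g)) /=.
  by apply: eq_bigr => l _; rewrite permKV.
move=> eq_ww'; rewrite !reindexE; apply: eq_bigr => l _.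
by case: ltnP => // /eq_ww' ->.
Qed.

(** The weights of [w] are squeezed between the equal weights of [u] and [v],
    and the position of [l] is the difference of two consecutive weights. *)
Lemma interval_small_values n (u v w : 'S_n) (k : nat) :
    (forall l : 'I_n, l < k -> (u^-1)%g l = (v^-1)%g l) ->
    w \in bruhat_interval u v ->
  forall l : 'I_n, l < k -> (w^-1)%g l = (u^-1)%g l.
Proof.
move=> eq_uv; rewrite inE => /andP[le_uw le_wv] l lt_lk.
have weight_w t : t <= k -> small_weight t w = small_weight t u.
  move=> le_tk; apply/eqP.
  rewrite eqn_leq [X in _ && X]small_weight_le // andbT.
  rewrite (@eq_small_weight _ u v t) ?small_weight_le // => i lt_it.
  exact: eq_uv (leq_trans lt_it le_tk).
apply/val_inj/eqP; rewrite -(eqn_add2l (small_weight l u)) -small_weightS.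
by rewrite -{1}(weight_w l (ltnW lt_lk)) -small_weightS (weight_w _ lt_lk).
Qed.

Lemma large_values_stable n (u w : 'S_n) (k : nat) :
    (forall l : 'I_n, l < k -> (w^-1)%g l = (u^-1)%g l) ->
  forall x, (k <= w x) = (k <= u x).
Proof.
move=> eq_wu x; rewrite leqNgt [in RHS]leqNgt; congr (~~ _).
apply/idP/idP => lt_k.
  by have /(congr1 u) := eq_wu _ lt_k; rewrite (permK w) (permKV u) => ->.
by have /(congr1 w) := eq_wu _ lt_k; rewrite (permK u) (permKV w) => <-.
Qed.

(** * Exchanging two positions of a class *)

Lemma mem_odd_diagram n (w : 'S_n) (i r : 'I_n) :
  ((i, w r) \in odd_diagram w) =
  [&& w r < w i, i < r & odd i != odd r].
Proof. by rewrite inE /= permK. Qed.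

(** Column [k] of the diagram, read in [v], consists of the positions before
    [b] of the parity opposite to [b] that carry a larger value; read in [u],
    it lies strictly before [a]. Hence it misses the window from [a] to [b]. *)
Lemma run_parity n (u v : 'S_n) (k a b : 'I_n) :
    odd_diagram u = odd_diagram v -> u a = k -> v b = k ->
    (forall x, (k <= v x) = (k <= u x)) ->
  forall i : 'I_n, a <= i <= b -> k <= u i -> odd i = odd a.
Proof.
move=> eqD ua vb large_uv.
(* First the parity of b, as v puts k there; it is then compared with a. *)
have same_b (i : 'I_n) : a <= i < b -> k <= u i -> odd i = odd b.
  case/andP=> le_ai lt_ib le_kui; apply/eqP/negPn/negP => ne_ib.
  have : (i, v b) \in odd_diagram v.
    rewrite mem_odd_diagram lt_ib ne_ib vb !andbT ltn_neqAle large_uv le_kui.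
    rewrite andbT; apply: contraTneq lt_ib => eq_kvi.
    have /perm_inj-> : v b = v i by apply/val_inj; rewrite vb.
    by rewrite ltnn.
  rewrite -eqD vb -ua mem_odd_diagram => /and3P[_ lt_ia _].
  by rewrite leqNgt lt_ia in le_ai.
move=> i /andP[le_ai]; rewrite leq_eqVlt => /orP[/eqP eq_ib _ | lt_ib le_kui].
  move: le_ai; rewrite leq_eqVlt => /orP[/eqP-> //|lt_ai].
  by rewrite eq_ib -(same_b a) // ?ua ?leqnn -?eq_ib.
rewrite (same_b i) ?le_ai // (same_b a) ?ua ?leqnn //.
exact: leq_ltn_trans le_ai lt_ib.
Qed.

(** Row [c] is compared with row [b] in [u]: the former would be contained in
    the latter beyond column [k], and row [b] is empty there because of [v]. *)
Lemma row_no_large n (u v : 'S_n) (k a b : 'I_n) :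
    odd_diagram u = odd_diagram v -> v b = k ->
    (forall i : 'I_n, a <= i <= b -> k <= u i -> odd i = odd a) ->
  forall c l : 'I_n, a <= c <= b -> k <= u c <= u b -> k < l ->
    (c, l) \notin odd_diagram u.
Proof.
move=> eqD vb parity c l /[dup] cab /andP[le_ac le_cb] /andP[le_kc le_ucb].
move=> lt_kl; apply/negP; rewrite -[l](permKV u); set r := (u^-1)%g l.
have ur : u r = l by rewrite permKV.
rewrite mem_odd_diagram ur => /and3P[lt_luc lt_cr ne_cr].
have eq_ca := parity c cab le_kc.
have lt_br : b < r.
  rewrite ltnNge; apply: contraNN ne_cr => le_rb.
  rewrite eq_ca (parity r) ?ur ?(ltnW lt_kl) // le_rb.
  by rewrite (leq_trans le_ac (ltnW lt_cr)).
have eq_ba : odd b = odd a.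
  by apply: parity; rewrite ?leqnn ?(leq_trans le_ac le_cb) ?(leq_trans le_kc).
have : (b, u r) \in odd_diagram u.
  by rewrite mem_odd_diagram lt_br eq_ba -eq_ca ne_cr ur (leq_trans lt_luc).
by rewrite eqD ur inE /= vb ltnNge (ltnW lt_kl).
Qed.

(** The only diagram points at stake are those whose row or value is at [p] or
    [q]. An entry above [w p] of the parity opposite to [p] lies on the same
    side of [p] and [q], so a point could only be lost from row [q] or gained
    in row [p] at a value between [w p] and [w q]. The latter would already be
    a point of row [q] for [w], and row [q] is empty beyond [w p]. The window from [lo] to [hi] makes the
    argument independent of the relative order of [p] and [q]. *)
Lemma odd_diagram_swap n (w : 'S_n) (p q : 'I_n) (lo hi : nat) :
    w p <= w q ->
    lo <= p <= hi -> lo <= q <= hi ->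
    (forall i : 'I_n, lo <= i <= hi -> w p <= w i -> odd i = odd p) ->
    (forall l : 'I_n, w p < l -> (q, l) \notin odd_diagram w) ->
  odd_diagram (tperm p q * w)%g = odd_diagram w.
Proof.
move=> le_pq p_in q_in parity row_q.
have eq_qp : odd q = odd p by apply: parity.
case: (eqVneq p q) => [<-|ne_pq]; first by rewrite tperm1 mul1g.
have lt_pq : w p < w q.
  by rewrite ltn_neqAle le_pq andbT (inj_eq val_inj) (inj_eq perm_inj).
apply/setP=> -[i l]; rewrite -[l](permKV w); set r := (w^-1)%g l.
have -> : ((i, w r) \in odd_diagram (tperm p q * w)%g) =
    [&& w r < w (tperm p q i), i < tperm p q r & odd i != odd (tperm p q r)].
  by rewrite inE /= invMg !permM tpermV permK.
rewrite mem_odd_diagram.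
(* An entry of the other parity and value above w p is on one side of both. *)
have same_side (x : 'I_n) : w p <= w x -> odd x != odd p ->
    ((x < p) = (x < q)) * ((p < x) = (q < x)).
  move=> le_px ne_xp.
  have : ~~ (lo <= x <= hi) by apply: contraNN ne_xp => /parity->.
  by move: p_in q_in => ??; split; lia.
(* The first two cases are the columns of the exchanged values w p and w q. *)
case: (tpermP p q r) => [->|->|/eqP ne_rp /eqP ne_rq].
- case: (tpermP p q i) => [->|->|_ _]; rewrite ?eq_qp ?eqxx ?andbF //.
  case: (ltnP (w p) (w i)) => //= lt_pi.
  case: eqVneq => //= ne_ip; rewrite ?andbF // !andbT.
  by rewrite (same_side i (ltnW lt_pi) ne_ip).
- case: (tpermP p q i) => [->|->|_ _]; rewrite ?eq_qp ?eqxx ?andbF //.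
  case: (ltnP (w q) (w i)) => //= lt_qi.
  case: eqVneq => //= ne_ip; rewrite ?andbF // !andbT.
  by rewrite (same_side i (ltnW (ltn_trans lt_pq lt_qi)) ne_ip).
have row_qr : w p < w r -> ~~ [&& w r < w q, q < r & odd q != odd r].
  by move=> /row_q; rewrite mem_odd_diagram.
(* The columns of the values that stay in place, at rows p and then q. *)
case: (tpermP p q i) => [->|->|_ _] //;
  case: (ltngtP (w p) (w r)) => [lt_pr|lt_rp|].
- rewrite /=; case: eqVneq => [|ne_pr]; rewrite ?andbF // !andbT.
  rewrite eq_sym in ne_pr.
  have := row_qr lt_pr; rewrite eq_qp eq_sym ne_pr andbT.
  by rewrite (same_side r (ltnW lt_pr) ne_pr) => /negbTE.
- by rewrite (ltn_trans lt_rp lt_pq).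
- by move/val_inj/perm_inj=> eq_pr; rewrite eq_pr eqxx in ne_rp.
- by rewrite (negbTE (row_qr lt_pr)).
- by rewrite (ltn_trans lt_rp lt_pq) eq_qp.
by move/val_inj/perm_inj=> eq_pr; rewrite eq_pr eqxx in ne_rp.
Qed.

Theorem theorem3p5 (n : nat) (D : {set 'I_n * 'I_n}) (u v : 'S_n)
    (k a b : 'I_n) (m : nat) (s : m.-tuple 'I_n)
    (D_odd : is_odd_diagram D)
    (class_gt1 : 1 < #|odd_diagram_class D|)
    (classE : odd_diagram_class D = bruhat_interval u v)
    (k_diff : (u^-1)%g k <> (v^-1)%g k)
    (k_min : forall i : 'I_n, (u^-1)%g i <> (v^-1)%g i -> k <= i)
    (aE : a = (u^-1)%g k)
    (bE : b = (v^-1)%g k)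
    (s_sorted : sorted (fun i j : 'I_n => i < j) s)
    (sE : [set i in s] =
          [set i : 'I_n | (a <= i <= b) && (u a <= u i <= u b)]) :
  forall i j : 'I_m, #|block u v k (tnth s i)| = #|block u v k (tnth s j)|.
Proof.
have inE_class w : (w \in bruhat_interval u v) = (odd_diagram w == D).
  by rewrite -classE inE.
have ua : u a = k by rewrite aE permKV.
have vb : v b = k by rewrite bE permKV.
have small_uv (l : 'I_n) : l < k -> (u^-1)%g l = (v^-1)%g l.
  by move=> lt_lk; apply: contraTeq lt_lk => /eqP/k_min; rewrite -leqNgt.
have large w : w \in bruhat_interval u v -> forall x, (k <= w x) = (k <= u x).
  by move=> w_in; apply/large_values_stable/(interval_small_values small_uv).
(* The class has an element, so u <= v and both ends belong to it. *)
have le_uv : bruhat u v.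
  have /card_gt0P[w] := ltnW class_gt1; rewrite classE inE.
  by case/andP; apply: connect_trans.
have u_in : u \in bruhat_interval u v.
  by rewrite inE le_uv andbT /bruhat connect0.
have v_in : v \in bruhat_interval u v by rewrite inE le_uv /bruhat connect0.
have Du : odd_diagram u = D by apply/eqP; rewrite -inE_class.
have eqD : odd_diagram u = odd_diagram v.
  by rewrite Du; apply/esym/eqP; rewrite -inE_class.
have parity := run_parity eqD ua vb (large v v_in).
have in_s (c : 'I_n) : c \in s -> (a <= c <= b) && (k <= u c <= u b).
  by move=> c_in; move/setP/(_ c): sE; rewrite !inE c_in ua => <-.
suff card_le p q : p \in s -> q \in s -> #|block u v k p| <= #|block u v k q|.
  by move=> i j; apply/eqP; rewrite eqn_leq !card_le ?mem_tnth.
move=> /in_s/andP[p_ab /andP[le_kp _]] /in_s/andP[q_ab le_kq].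
have inj_swap : injective (fun w : 'S_n => (tperm p q * w)%g) by apply: mulgI.
rewrite -(card_imset _ inj_swap); apply/subset_leq_card/subsetP => w'.
case/imsetP=> w.
rewrite inE => /andP[w_in /eqP wk] ->.
have wp : w p = k by rewrite -wk permKV.
have Dw : odd_diagram w = D by apply/eqP; rewrite -inE_class.
rewrite inE invMg permM wk tpermV tpermL eqxx andbT inE_class.
rewrite (@odd_diagram_swap _ w p q a b) ?Dw //.
- by rewrite wp (large w w_in); case/andP: le_kq.
- move=> i i_ab; rewrite wp (large w w_in) => le_ki.
  by rewrite (parity i i_ab le_ki) (parity p p_ab le_kp).
move=> l; rewrite wp -Du => lt_kl.
exact: (row_no_large eqD vb parity q_ab le_kq lt_kl).
Qed.
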